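(* Let $q$ be a complex number with $0<|q|<1$. Let $(\alpha_n,\beta_n)_{n\ge 0}$ be a Bailey pair relative to $q$, and let $(f_n)_{n\in\mathbb{Z}}$ be a sequence defined for all integers $n$ which satisfies $$\alpha_n=\frac{1-q^{2n+1}}{1-q}f_n\qquad (n\geq 0)$$ and $$q^{n}f_n=-q^{-n-1}f_{-n-1}\qquad (n\in\mathbb{Z}).$$ Then for all integers $m\ge 1$ and $0\le a\le m$ (such that the multiple series on the left and the series on the right below converge absolutely), the sum $$\sum_{n_m,\dots,n_1\ge 0}\frac{(-1)^{n_m}q^{\binom{n_m+1}{2}+\cdots+\binom{n_1+1}{2}}(q^2;q^2)_{n_1+\delta_{a,0}}}{(-q)_{n_m}}\,\beta_{n_1+\delta_{a,0}}\prod_{i=1}^{m-1}\begin{bmatrix} n_{i+1}+\delta_{a,i}\\ n_i\end{bmatrix}$$ is equal to $$\begin{cases}\displaystyle\sum_{n\in\mathbb{Z}}\mathrm{sgn}(-n)(-1)^nq^{m\binom{n}{2}+an}f_n & \text{if } 0\le a\le m-1,\\[2mm] \displaystyle\sum_{n\in\mathbb{Z}}\mathrm{sgn}(n)(-1)^nq^{m\binom{n+1}{2}}f_n & \text{if } a=m.\end{cases}$$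
   Context: Notation: $(x;p)_n=\prod_{j=0}^{n-1}(1-xp^j)$ for $n\ge 0$ and $(x)_n=(x;q)_n$. The $q$-binomial coefficient is $\begin{bmatrix} n\\k\end{bmatrix}=\frac{(q)_n}{(q)_{n-k}(q)_k}$ if $0\le k\le n$, and $0$ otherwise. $\binom{n}{2}=n(n-1)/2$ for every integer $n$; $\delta_{i,j}$ is the Kronecker delta; empty products equal $1$. The function $\mathrm{sgn}$ is defined by $\mathrm{sgn}(n)=1$ if $n\ge 0$ and $\mathrm{sgn}(n)=-1$ if $n<0$ (so $\mathrm{sgn}(0)=1$). A Bailey pair relative to $x$ is a pair of sequences $(\alpha_n,\beta_n)_{n\ge 0}$ satisfying $\beta_n=\sum_{k=0}^n\frac{\alpha_k}{(q)_{n-k}(xq)_{n+k}}$ for all $n\ge 0$. *)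

(* Defs.v *)
From HB Require Import structures.
From mathcomp Require Import all_boot all_order all_algebra finmap.
From mathcomp Require Import complex.
From mathcomp Require Import boolp classical_sets reals ereal topology normedtype.
From mathcomp Require esum.
From mathcomp.analysis.showcase Require summability.

Set Implicit Arguments.
Unset Strict Implicit.
Unset Printing Implicit Defensive.

Import Order.TTheory GRing.Theory Num.Theory.
Import numFieldNormedType.Exports.

Local Open Scope ring_scope.

(* (x; p)_n *)
Definition qpoch (K : fieldType) (x p : K) (n : nat) : K :=
  \prod_(j < n) (1 - x * p ^+ j).

Definition qbinom (K : fieldType) (q : K) (n k : nat) : K :=
  if (k <= n)%N then qpoch q q n / (qpoch q q (n - k) * qpoch q q k) else 0.

(* binom(n, 2) for an arbitrary integer n; the division is exact. *)
Definition binz2 (n : int) : int := ((n * (n - 1)) %/ 2)%Z.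

(* Unlike sgz, this takes the value 1 at 0. *)
Definition sgn (n : int) : int := if 0 <= n then 1 else -1.

Definition bailey_pair (K : fieldType) (q x : K) (alpha beta : nat -> K) : Prop :=
  forall n : nat, beta n =
    \sum_(k < n.+1) alpha k / (qpoch q q (n - k) * qpoch (x * q) q (n + k)).

(* Absolute convergence and sum of a complex series indexed by a choiceType.
   The sum is the limit of the finite partial sums along the filter of finite
   subsets of T; it exists as soon as the series converges absolutely. *)
Definition abs_convergent (R : realType) (T : choiceType) (F : T -> R[i]) : Prop :=
  esum.summable [set: T]%classic (fun t => (Normc.normc (F t))%:E).

Definition series_sum (R : realType) (T : choiceType) (F : T -> R[i]) : R[i] :=
  @summability.sum T R[i] R[i]^o F.

(* A tuple (n_1, ..., n_m) is stored from position 0, while n_i is 1-based;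
   it is only used for 1 <= i <= m. *)
Definition ith (m : nat) (n : m.-tuple nat) (i : nat) : nat := nth 0%N n i.-1.

(* The boolean equalities (a == 0) and (a == i), coerced to nat, are the
   Kronecker deltas. *)
Definition multisum_term (K : fieldType) (q : K) (beta : nat -> K)
    (a m : nat) (n : m.-tuple nat) : K :=
  (-1) ^+ ith n m * q ^+ (\sum_(1 <= i < m.+1) 'C((ith n i).+1, 2))%N
  * qpoch (q ^+ 2) (q ^+ 2) (ith n 1 + (a == 0))%N / qpoch (- q) q (ith n m)
  * beta (ith n 1 + (a == 0))%N
  * \prod_(1 <= i < m) qbinom q (ith n i.+1 + (a == i))%N (ith n i).

Definition bilateral_term (K : fieldType) (q : K) (f : int -> K)
    (a m : nat) (n : int) : K :=
  if (a < m)%N then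
    (sgn (- n))%:~R * (-1) ^ n * q ^ (m%:Z * binz2 n + a%:Z * n) * f n
  else
    (sgn n)%:~R * (-1) ^ n * q ^ (m%:Z * binz2 (n + 1)) * f n.

(* Main.v *)
Require Import Defs.
From mathcomp Require Import all_boot all_order all_algebra finmap.
From mathcomp Require Import complex.
From mathcomp Require Import classical_sets fsbigop.
From mathcomp Require Import reals ereal topology normedtype sequences exp.
From mathcomp Require esum.
From mathcomp.analysis.showcase Require summability.
From mathcomp Require Import ring lra zify.
Import Order.TTheory GRing.Theory Num.Theory.
Import numFieldNormedType.Exports.
Local Open Scope ring_scope.

Set Implicit Arguments.
Unset Strict Implicit.

(** Put S_k(n) = 1 / ((q)_{n-k} (q)_{n+1+k}).  The symmetry of f turns the Bailey pair
    into beta_n = sum_{k in Z} f_k S_k(n).  One summation of the multisum, performed on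
    (q^2;q^2)_n S_k(n), reproduces the same function times q^binom(k+1,2): this is the
    Bailey lemma with parameter -q, a case of q-Chu-Vandermonde.  The shift n -> n+1
    caused by the Kronecker delta replaces S_k by S_{k-1}, because q^k f_k is odd under
    k -> -k-1; from then on each step contributes q^binom(k,2) instead.

    Absolute convergence of the two series does not allow the outermost sum over n_m to
    be exchanged with the sum over k.  Instead the term of the multisum is multiplied by
    (q)_N / (q)_{N-n_m}; the Bailey lemma with parameter q then gives the exact finite
    identity in which the bilateral term of index k carries the weight (q)_N^2 S_k(N) or
    (q)_N^2 S_{k-1}(N).  Both families of weights are bounded and tend to 1, so both
    sides converge by dominated convergence as N tends to infinity. *)

(** * Bailey steps *)

Lemma bin2D (m n : nat) : 'C((m + n)%N, 2) = ('C(m, 2) + 'C(n, 2) + m * n)%N.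
Proof.
elim: m => [|m IHm]; first by rewrite mul0n addn0.
by rewrite addSn !binS !bin1 IHm mulSn; lia.
Qed.

Section QSeries.

Variables (K : fieldType) (q : K).

Lemma qpochS x p n : qpoch x p n.+1 = qpoch x p n * (1 - x * p ^+ n) :> K.
Proof. by rewrite /qpoch big_ord_recr. Qed.

Lemma qpoch0 x p : qpoch x p 0 = 1 :> K.
Proof. by rewrite /qpoch big_ord0. Qed.

Lemma qpochD x p m n : qpoch x p (m + n) = qpoch x p m * qpoch (x * p ^+ m) p n :> K.
Proof.
elim: n => [|n IHn]; first by rewrite addn0 qpoch0 mulr1.
by rewrite addnS !qpochS IHn exprD !mulrA.
Qed.

Lemma qpoch_sqr n : qpoch (q ^+ 2) (q ^+ 2) n = qpoch q q n * qpoch (- q) q n.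
Proof.
elim: n => [|n IHn]; first by rewrite !qpoch0 mulr1.
by rewrite !qpochS IHn -exprM mulnC exprM; ring.
Qed.

Hypothesis hq : forall n, 1 - q ^+ n.+1 != 0.

Lemma qpoch_neq0 n : qpoch q q n != 0.
Proof. by apply/prodf_neq0 => i _; rewrite -exprS. Qed.

Lemma qbinom_pochM n j : (j <= n)%N ->
  qbinom q n j * qpoch q q j = qpoch q q n / qpoch q q (n - j).
Proof.
by move=> jn; rewrite /qbinom jn; field; rewrite !qpoch_neq0.
Qed.

Lemma qbinom_small n j : (n < j)%N -> qbinom q n j = 0.
Proof. by move=> nj; rewrite /qbinom leqNgt nj. Qed.

Lemma qbinom0 n : qbinom q n 0 = 1.
Proof. by rewrite /qbinom leq0n subn0 qpoch0 mulr1 divff // qpoch_neq0. Qed.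

(** In this form of the q-Pascal rule [q ^+ (n - j)] meets the [q ^+ j] gained by
    [q ^+ 'C(j.+1, 2)], which leaves a power free of j. *)
Lemma qbinomS n j : (j <= n)%N ->
  qbinom q n.+1 j.+1 = qbinom q n j.+1 + q ^+ (n - j) * qbinom q n j.
Proof.
rewrite leq_eqVlt => /predU1P[->|jn].
  rewrite (qbinom_small (ltnSn n)) subnn mul1r add0r.
  by rewrite /qbinom !leqnn !subnn qpoch0 !mul1r !divff ?qpoch_neq0.
move/subnK: jn; move: (n - j.+1)%N => d <-.
have leqs : (j.+1 <= (d + j.+1).+1)%N && (j <= d + j.+1)%N by lia.
rewrite /qbinom leq_addl; case/andP: leqs => -> ->.
rewrite subSS addnK (_ : d + j.+1 - j = d.+1)%N; last by lia.
have := hq (d + j.+1); have := hq j; have := hq d.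
rewrite !qpochS -!exprS (_ : (d + j.+1).+1 = d.+1 + j.+1)%N // exprD.
by move=> h1 h2 h3; field; rewrite !qpoch_neq0 h1 h2.
Qed.

(* The variable b is general because the q-Pascal rule shifts it to b q. *)
Lemma q_chu_vandermonde b d N :
  \sum_(i < N.+1) qbinom q N i * (-1) ^+ i * q ^+ 'C(i, 2) * d ^+ i
     * qpoch b q i * qpoch (b * d * q ^+ i) q (N - i) = qpoch d q N.
Proof.
elim: N b => [|N IHN] b.
  by rewrite big_ord1 qbinom0 !qpoch0 !mulr1.
rewrite big_ord_recl /=.
(* The second summand of q-Pascal gives the same sum with b replaced by b q, times a factor
   independent of i. *)
rewrite (eq_bigr (fun i : 'I_N.+1 =>
   qbinom q N i.+1 * (-1) ^+ i.+1 * q ^+ 'C(i.+1, 2) * d ^+ i.+1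
     * qpoch b q i.+1 * qpoch (b * d * q ^+ i.+1) q (N - i)
   + (- d * q ^+ N * (1 - b)) * (qbinom q N i * (-1) ^+ i * q ^+ 'C(i, 2) * d ^+ i
     * qpoch (b * q) q i * qpoch ((b * q) * d * q ^+ i) q (N - i)))); last first.
  move=> i _; have iN : (i <= N)%N by rewrite -ltnS.
  rewrite /bump /= add1n subSS qbinomS // mulrDl !mulrDl; congr (_ + _).
  rewrite binS bin1 exprD -[i.+1]add1n (qpochD b q 1) qpochS qpoch0 expr1 add1n.
  have -> : q ^+ N = q ^+ (N - i) * q ^+ i by rewrite -exprD subnK.
  rewrite !exprS (_ : b * d * (q * q ^+ i) = b * q * d * q ^+ i); first by ring.
  by ring.
rewrite big_split /= -big_distrr /= IHN addrA.
(* The first summand, with the term i = 0, is the sum for N and b in which every last factor has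
   gained 1 - b d q^N. Adding -d q^N (1 - b) to this leaves 1 - d q^N. *)
have -> : qbinom q N.+1 0 * (-1) ^+ 0 * q ^+ 'C(0, 2) * d ^+ 0 * qpoch b q 0 *
   qpoch (b * d * q ^+ 0) q (N.+1 - 0) + \sum_(i < N.+1)
    qbinom q N i.+1 * (-1) ^+ i.+1 * q ^+ 'C(i.+1, 2) * d ^+ i.+1
     * qpoch b q i.+1 * qpoch (b * d * q ^+ i.+1) q (N - i) =
  (1 - b * d * q ^+ N) * qpoch d q N.
  rewrite -(IHN b) big_ord_recr /= (qbinom_small (ltnSn N)) !mul0r addr0 [in RHS]big_ord_recl.
  rewrite !qbinom0 mulrDr big_distrr /=; congr (_ + _).
    by rewrite !subn0 qpochS expr0 !mulr1; ring.
  apply: eq_bigr => i _; rewrite /bump /= add1n.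
  have -> : q ^+ N = q ^+ i.+1 * q ^+ (N - i.+1) by rewrite -exprD subnKC.
  by rewrite -(subnSK (ltn_ord i)) (qpochS (_ * q ^+ i.+1)); ring.
by rewrite qpochS; ring.
Qed.


(* [invpoch z] is 1/(q)_z with the usual convention that it vanishes for z < 0. *)
Definition invpoch (z : int) : K :=
  if z is Posz n then (qpoch q q n)^-1 else 0.

(* For k >= 0 this is 1 / (1 - q) times the coefficient of alpha_k in beta_n for a
   Bailey pair relative to q. *)
Definition bailey_ker (k : int) (n : nat) : K :=
  invpoch (n%:Z - k) * invpoch (n%:Z + 1 + k).

(** The recurrence extends to negative z because its factor vanishes at z = -1. *)
Lemma invpochS z : invpoch z = (1 - q ^ (z + 1)) * invpoch (z + 1).
Proof.
case: z => [n|[|n]].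
- rewrite /= addn1 qpochS -exprS -exprnP addn1.
  by field; rewrite qpoch_neq0 hq.
- by rewrite expr0z subrr mul0r.
- have -> : Negz n.+1 + 1 = Negz n by lia.
  by rewrite mulr0.
Qed.

(** The reflection k -> -k-1 exchanges the two factors of the kernel. *)
Lemma bailey_ker_sym k n : bailey_ker (- k - 1) n = bailey_ker k n.
Proof.
rewrite /bailey_ker mulrC; congr (invpoch _ * invpoch _); lia.
Qed.

Lemma bailey_ker_pos (k n : nat) : (k <= n)%N ->
  bailey_ker k n = (qpoch q q (n - k) * qpoch q q (n + k).+1)^-1.
Proof.
move=> kn; rewrite /bailey_ker.
have -> : n%:Z - k%:Z = (n - k)%N by lia.
have -> : n%:Z + 1 + k%:Z = (n + k).+1 by lia.
by rewrite /= invfM.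
Qed.

Lemma bailey_ker_eq0 (k : int) n : (n%:Z < k) || (k < - n%:Z - 1) -> bailey_ker k n = 0.
Proof.
rewrite /bailey_ker; case/orP => h.
  have -> : n%:Z - k = Negz (absz (k - n%:Z)).-1 by lia.
  by rewrite mul0r.
have -> : n%:Z + 1 + k = Negz (absz (n%:Z + 1 + k)).-1 by lia.
by rewrite mulr0.
Qed.

(* Conjugate Bailey pair: [e = -1] is one step of the chain with parameter -q,
   [e = 1] is the step with parameter q. *)
Lemma bailey_step_nat (e : K) B n (k : nat) : e ^+ 2 = 1 -> (n < B)%N ->
  \sum_(j < B) qbinom q n j * (- e) ^+ j * q ^+ 'C(j.+1, 2)
     * qpoch q q j * qpoch (e * q) q j * bailey_ker k j
  = (- e) ^+ k * q ^+ 'C(k.+1, 2) * qpoch q q n * qpoch (e * q) q n * bailey_ker k n.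
Proof.
move=> e2 nB; have [kn|nk] := leqP k n; last first.
  rewrite [bailey_ker k n]bailey_ker_eq0 ?mulr0; last lia.
  apply: big1 => j _; have [jn|nj] := leqP j n.
    by rewrite bailey_ker_eq0 ?mulr0 //; lia.
  by rewrite (qbinom_small nj) !mul0r.
(* Only k <= j <= n contributes: the q-binomial vanishes above n, the kernel below k. *)
rewrite -(big_mkord xpredT (fun j => qbinom q n j * (- e) ^+ j * q ^+ 'C(j.+1, 2)
     * qpoch q q j * qpoch (e * q) q j * bailey_ker k j)).
rewrite (big_cat_nat _ (n := n.+1)) //= [X in _ + X]big_nat_cond [X in _ + X]big1; last first.
  by move=> j /andP[/andP[nj _] _]; rewrite (qbinom_small nj) !mul0r.
rewrite addr0 (big_cat_nat _ (n := k)) //=; last exact: leqW.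
rewrite [X in X + _]big_nat_cond [X in X + _]big1; last first.
  by move=> j /andP[/andP[_ jk] _]; rewrite bailey_ker_eq0 ?mulr0 //; lia.
rewrite add0r -{1}(add0n k) big_addn subSn // big_mkord.
set N := (n - k)%N; have nE : n = (N + k)%N by rewrite subnK.
rewrite (bailey_ker_pos kn) -/N.
(* The sum over j = k + i is q-Chu-Vandermonde with b = d = e q^(k+1). *)
transitivity ((- e) ^+ k * q ^+ 'C(k.+1, 2) * qpoch q q n * qpoch (e * q) q k
   / (qpoch q q N * qpoch q q (n + k).+1) *
   (\sum_(i < N.+1) qbinom q N i * (-1) ^+ i * q ^+ 'C(i, 2) * (e * q ^+ k.+1) ^+ i
     * qpoch (e * q ^+ k.+1) q i
     * qpoch (e * q ^+ k.+1 * (e * q ^+ k.+1) * q ^+ i) q (N - i))); last first.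
  have -> : qpoch (e * q) q n = qpoch (e * q) q k * qpoch (e * q ^+ k.+1) q N.
    by rewrite nE addnC qpochD exprS mulrA.
  by rewrite q_chu_vandermonde; field; rewrite !qpoch_neq0.
rewrite big_distrr /=; apply: eq_bigr => i _.
have iN : (i <= N)%N by rewrite -ltnS.
have ikn : (i + k <= n)%N by rewrite nE leq_add2r.
have kik : (k <= i + k)%N by rewrite leq_addl.
rewrite (bailey_ker_pos kik) addnK.
have -> : qbinom q n (i + k) = qpoch q q n / (qpoch q q (N - i) * qpoch q q (i + k)).
  by rewrite /qbinom ikn (_ : n - (i + k) = N - i)%N //; lia.
have -> : qbinom q N i = qpoch q q N / (qpoch q q (N - i) * qpoch q q i).
  by rewrite /qbinom iN.
(* Here e^2 = 1 makes b d q^i free of e, so the last q-Chu-Vandermonde factor completes (q)_(j+k+1)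
   to (q)_(n+k+1). *)
have -> : e * q ^+ k.+1 * (e * q ^+ k.+1) * q ^+ i = q * q ^+ (i + k + k).+1.
  rewrite mulrACA -expr2 e2 mul1r -!exprD -exprS; congr (q ^+ _); lia.
have -> : (n + k).+1 = ((i + k + k).+1 + (N - i))%N by lia.
rewrite (qpochD q q (i + k + k).+1); have := qpoch_neq0 ((i + k + k).+1 + (N - i)); rewrite qpochD.
rewrite mulf_eq0 negb_or => /andP[_ h2].
have -> : qpoch (e * q) q (i + k) = qpoch (e * q) q k * qpoch (e * q ^+ k.+1) q i.
  by rewrite addnC qpochD exprS mulrA.
rewrite -addnS bin2D.
rewrite !exprD exprMn [(q ^+ k.+1) ^+ i]exprAC -exprM [(- e) ^+ i]exprNn.
by field; rewrite !qpoch_neq0 h2.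
Qed.

End QSeries.

(** * Binomials of integers and symmetric windows *)

Lemma binz2_nat (n : nat) : binz2 n = 'C(n, 2).
Proof.
have e : n%:Z * (n%:Z - 1) = 'C(n, 2)%:Z * 2.
  by elim: n => [|n IHn]; [rewrite mul0r | rewrite binS bin1; lia].
by rewrite /binz2 e mulzK.
Qed.

Lemma binz2D1 n : binz2 (n + 1) = binz2 n + n.
Proof.
rewrite /binz2 (_ : (n + 1) * (n + 1 - 1) = n * 2 + n * (n - 1)); last by ring.
by rewrite divzMDl // addrC.
Qed.

Lemma binz2_sym n : binz2 (1 - n) = binz2 n.
Proof. by rewrite /binz2; congr (_ %/ _)%Z; ring. Qed.

(** The range -M <= k < M is stable under k -> -k-1, which exchanges [Posz j] and [Negz j]. *)
Definition window (M : nat) : seq int := map Posz (iota 0 M) ++ map Negz (iota 0 M).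

Lemma mem_window M k : (k \in window M) = (- M%:Z <= k < M%:Z).
Proof.
rewrite mem_cat; case: k => k.
  rewrite mem_map => [|? ? []] //; rewrite mem_iota.
  rewrite [X in _ || X](_ : _ = false) ?orbF; first lia.
  by apply/negbTE/mapP => -[].
rewrite [X in X || _](_ : _ = false) /=; last by apply/negbTE/mapP => -[].
by rewrite mem_map => [|? ? []] //; rewrite mem_iota; lia.
Qed.

Lemma window_uniq M : uniq (window M).
Proof.
rewrite cat_uniq !map_inj_uniq ?iota_uniq => [|? ? []|? ? []] //=.
by rewrite andbT; apply/hasPn => _ /mapP[k _ ->]; apply/mapP => -[].
Qed.

Lemma sum_window (V : nmodType) M (u : int -> V) :
  \sum_(k <- window M) u k = \sum_(j < M) (u j + u (- j%:Z - 1)).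
Proof.
rewrite big_cat !big_map big_split /= -[M in iota _ M]subn0.
rewrite -!/(index_iota 0 M) !big_mkord; congr (_ + _).
by apply: eq_bigr => j _; congr u; lia.
Qed.

Lemma sum_window_odd (V : zmodType) M (u : int -> V) :
  (forall k, u (- k - 1) = - u k) -> \sum_(k <- window M) u k = 0.
Proof. by move=> uN; rewrite sum_window big1 // => j _; rewrite uN subrr. Qed.

(** * Bailey steps at all integer indices, the shift, and the folded Bailey pair *)

Section Chain.

Variables (K : fieldType) (q : K).
Hypothesis q0 : q != 0.
Hypothesis hq : forall n, 1 - q ^+ n.+1 != 0.

Let ker_negz k n : bailey_ker q (Negz k) n = bailey_ker q k n.
Proof. by rewrite (_ : Negz k = - k%:Z - 1) ?bailey_ker_sym //; lia. Qed.

Let binz2_posz (k : nat) : binz2 (k%:Z + 1) = 'C(k.+1, 2).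
Proof. by rewrite (_ : k%:Z + 1 = k.+1) ?binz2_nat //; lia. Qed.

Let binz2_negz (k : nat) : binz2 (Negz k + 1) = 'C(k.+1, 2).
Proof. by rewrite -binz2_sym -binz2_nat; congr binz2; lia. Qed.

(** The case e = -1, where (q)_j (-q)_j = (q^2;q^2)_j. Negative k follow by reflection, as the
    kernel and [binz2 (k + 1)] are invariant. *)
Lemma bailey_step_qN B n (k : int) : (n < B)%N ->
  \sum_(j < B) qbinom q n j * q ^+ 'C(j.+1, 2)
     * (qpoch (q ^+ 2) (q ^+ 2) j * bailey_ker q k j)
  = q ^ binz2 (k + 1) * (qpoch (q ^+ 2) (q ^+ 2) n * bailey_ker q k n).
Proof.
move=> nB; wlog [{}k ->] : k / exists k' : nat, k = k'.
  case: k => k H; first by apply: H; exists k.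
  rewrite ker_negz binz2_negz -binz2_posz -H; last by exists k.
  by apply: eq_bigr => j _; rewrite ker_negz.
have e2 : (-1) ^+ 2 = 1 :> K by rewrite sqrrN expr1n.
rewrite binz2_posz -exprnP.
apply: etrans (etrans _ (bailey_step_nat hq k e2 nB)) _.
- by apply: eq_bigr => j _; rewrite qpoch_sqr opprK expr1n mulN1r; ring.
- by rewrite qpoch_sqr opprK expr1n mulN1r; ring.
Qed.

(** The case e = 1. Reflection changes the sign of (-1)^k and [sgn k] compensates: this is the
    origin of the sign function in the theorem. *)
Lemma bailey_step_q B n (k : int) : (n < B)%N ->
  \sum_(j < B) qbinom q n j * (-1) ^+ j * q ^+ 'C(j.+1, 2)
     * (qpoch q q j * qpoch q q j * bailey_ker q k j)
  = (sgn k)%:~R * (-1) ^ k * q ^ binz2 (k + 1) *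
     (qpoch q q n * qpoch q q n * bailey_ker q k n).
Proof.
move=> nB; wlog [{}k ->] : k / exists k' : nat, k = k'.
  case: k => k H; first by apply: H; exists k.
  transitivity ((sgn k)%:~R * (-1) ^ k%:Z * q ^ binz2 (k%:Z + 1) *
     (qpoch q q n * qpoch q q n * bailey_ker q k n)).
    by rewrite -H; [apply: eq_bigr => j _; rewrite ker_negz | exists k].
  rewrite ker_negz binz2_negz binz2_posz; congr (_ * _ * _).
  rewrite /sgn /= mul1r NegzE -exprnN -exprVn invrN1 exprS.
  by rewrite mulrA mulrNN mulr1 mul1r.
rewrite binz2_posz -!exprnP [sgn _]/= mul1r.
apply: etrans (etrans _ (bailey_step_nat hq k (expr1n _ _) nB)) _.
- by apply: eq_bigr => j _; rewrite mul1r; ring.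
- by rewrite mul1r; ring.
Qed.

(** The two sides differ by a sum over the window of a function that is odd under k -> -k-1. *)
Lemma bailey_shift M n (F : int -> K) :
  (forall k, q ^ k * F k = - q ^ (- k - 1) * F (- k - 1)) ->
  (1 - q ^+ 2 * (q ^+ 2) ^+ n) * (\sum_(k <- window M) F k * bailey_ker q k n.+1)
  = \sum_(k <- window M) F k * bailey_ker q (k - 1) n.
Proof.
move=> hF; apply/esym/eqP; rewrite -subr_eq0 big_distrr -sumrB; apply/eqP => /=.
(* This is F_k S_k(n+1) times (1 - q^(n+1+k))(1 - q^(n+2+k)) - (1 - q^(2n+2)), with q^k factored
   out; the remaining bracket is invariant under reflection. *)
pose u k := q ^ k * F k * bailey_ker q k n.+1 *
   (- q ^ (n%:Z + 1) * (1 + q) + q ^ (2 * n%:Z + 2) * (q ^ (k + 1) + q ^ (- k))).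
rewrite (eq_bigr u) => [|k _].
  apply: sum_window_odd => k; rewrite /u bailey_ker_sym hF mulNr.
  rewrite (_ : - (- k - 1) - 1 = k); last by ring.
  rewrite (_ : - k - 1 + 1 = - k); last by ring.
  rewrite (_ : - (- k - 1) = k + 1); last by ring.
  by ring.
have -> : bailey_ker q (k - 1) n =
    (1 - q ^ (n%:Z + 1 + k)) * (1 - q ^ (n%:Z + 2 + k)) * bailey_ker q k n.+1.
  rewrite /bailey_ker (_ : n%:Z - (k - 1) = n.+1%:Z - k); last by lia.
  rewrite (_ : n%:Z + 1 + (k - 1) = n%:Z + k); last by lia.
  rewrite (invpochS hq (n%:Z + k)) (invpochS hq (n%:Z + k + 1)).
  rewrite (_ : n%:Z + k + 1 = n%:Z + 1 + k); last by lia.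
  rewrite (_ : n%:Z + 1 + k + 1 = n%:Z + 2 + k); last by lia.
  rewrite (_ : n.+1%:Z + 1 + k = n%:Z + 2 + k); last by lia.
  by ring.
have e2 : 2 * n%:Z + 2 = n%:Z + n%:Z + 1 + 1 by ring.
rewrite /u e2 (_ : n%:Z + 2 + k = n%:Z + 1 + 1 + k); last by lia.
rewrite -exprM mulnC exprM !expfzDr // expr1z -!exprnP -invr_expz.
by field; rewrite expfz_neq0.
Qed.

(** The symmetry gives f_(-k-1) = -q^(2k+1) f_k, so k and -k-1 together contribute (1 - q^(2k+1))
    f_k, as in alpha_k; the denominator 1 - q completes (q^2)_(n+k) to (q)_(n+k+1). *)
Lemma bailey_pair_fold (alpha beta : nat -> K) (f : int -> K) n M :
  bailey_pair q q alpha beta ->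
  (forall n : nat, alpha n = (1 - q ^+ (2 * n + 1)) / (1 - q) * f n%:Z) ->
  (forall n : int, q ^ n * f n = - q ^ (- n - 1) * f (- n - 1)) ->
  (n < M)%N -> beta n = \sum_(k <- window M) f k * bailey_ker q k n.
Proof.
move=> hab hf hsym nM; rewrite hab sum_window.
rewrite -(big_mkord xpredT (fun k => f k * bailey_ker q k n +
   f (- k%:Z - 1) * bailey_ker q (- k%:Z - 1) n)).
rewrite (big_cat_nat _ (n := n.+1)) //= [X in _ + X]big_nat_cond [X in _ + X]big1; last first.
  move=> j /andP[/andP[nj _] _].
  by rewrite bailey_ker_sym !bailey_ker_eq0 ?mulr0 ?addr0 //; lia.
rewrite addr0 big_mkord; apply: eq_bigr => k _.
rewrite bailey_ker_sym hf bailey_ker_pos; last by rewrite -ltnS.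
rewrite -[(n + k).+1]add1n (qpochD q q 1) qpochS qpoch0 expr0 expr1 mulr1 mul1r.
have -> : f (- k%:Z - 1) = - q ^+ (2 * k + 1) * f k.
  have e : q ^ (- k%:Z - 1) != 0 by rewrite expfz_neq0.
  apply: (mulfI e); apply: oppr_inj; rewrite -mulNr -hsym.
  rewrite mulNr mulrN opprK mulrA exprnP -expfzDr //; congr (q ^ _ * _); lia.
have := hq 0; rewrite expr1 => q1.
have := qpoch_neq0 hq (n + k).+1; rewrite -add1n (qpochD q q 1) mulf_eq0 negb_or expr1.
move=> /andP[_ h].
by field; rewrite !qpoch_neq0 // q1 h.
Qed.

End Chain.

(** * The multisum *)

Lemma sum_tuple_cons (V : nmodType) (T : finType) m (G : m.+1.-tuple T -> V) :
  \sum_t G t = \sum_x \sum_(t : m.-tuple T) G [tuple of x :: t].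
Proof.
rewrite pair_big (reindex (fun p : T * m.-tuple T => [tuple of p.1 :: p.2])) //=.
exists (fun t => (thead t, [tuple of behead t])) => [[x t] _ | t _] /=.
  by congr pair; apply/val_inj.
by rewrite -tuple_eta.
Qed.

Section Transfer.

Variables (K : fieldType) (B : nat) (g : nat -> K).

(** Transfer-matrix form of the nested sums: n_1, ..., n_i are summed with n_(i+1) = y held
    fixed. *)
Fixpoint chain (c : nat -> nat -> nat -> K) (h : nat -> K) i y : K :=
  if i is i'.+1 then \sum_(x < B) c i' y x * g x * chain c h i' x else h y.

(** Unrolls the innermost sum instead of the outermost one, to match a tuple that loses its head
    n_1. *)
Lemma chainSr (c : nat -> nat -> nat -> K) (h : nat -> K) i y :
  chain c h i.+1 y = chain (fun j => c j.+1) (chain c h 1) i y.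
Proof.
elim: i y => [|i IHi] y //.
rewrite [LHS](_ : _ = \sum_(x < B) c i.+1 y x * g x * chain c h i.+1 x) //.
by apply: eq_bigr => x _; rewrite IHi.
Qed.

Lemma sum_tuple_chain (c : nat -> nat -> nat -> K) (h phi : nat -> K) m :
  \sum_(t : m.+1.-tuple 'I_B) (h (nth 0%N (map val t) 0)
     * (\prod_(i < m.+1) g (nth 0%N (map val t) i))
     * (\prod_(i < m) c i (nth 0%N (map val t) i.+1) (nth 0%N (map val t) i))
     * phi (nth 0%N (map val t) m))
  = \sum_(x < B) phi x * g x * chain c h m x.
Proof.
elim: m c h => [|m IHm] c h; rewrite sum_tuple_cons.
  apply: eq_bigr => x _; rewrite (big_pred1 [tuple]) => [|t]; last first.
    by rewrite [t]tuple0; apply/esym/eqP.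
  by rewrite /= big_ord1 big_ord0 /=; ring.
under [RHS]eq_bigr do rewrite chainSr.
rewrite -IHm exchange_big; apply: eq_bigr => t _ /=.
rewrite !big_distrl /=; apply: eq_bigr => x _.
by rewrite [in LHS]big_ord_recl /= [X in _ * X * _]big_ord_recl /=; ring.
Qed.

End Transfer.

Section Multisum.

Variables (K : fieldType) (q : K).
Hypothesis q0 : q != 0.
Hypothesis hq : forall n, 1 - q ^+ n.+1 != 0.
Hypothesis hNq : forall n, qpoch (- q) q n != 0.
Variables (alpha beta : nat -> K) (f : int -> K).
Hypothesis hab : bailey_pair q q alpha beta.
Hypothesis hf : forall n : nat, alpha n = (1 - q ^+ (2 * n + 1)) / (1 - q) * f n%:Z.
Hypothesis hsym : forall n : int, q ^ n * f n = - q ^ (- n - 1) * f (- n - 1).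
Variables (a B M : nat).
Hypothesis BM : (B <= M)%N.

Let g (x : nat) : K := q ^+ 'C(x.+1, 2).
Let h (x : nat) : K := qpoch (q ^+ 2) (q ^+ 2) (x + (a == 0))%N * beta (x + (a == 0))%N.
(** Positions start at 0: [c i] links n_(i+1) to n_(i+2), hence the test against [i.+1]. The delta
    for a = 0 sits in [h]. *)
Let c (i y x : nat) : K := qbinom q (y + (a == i.+1))%N x.
Let H := chain B g c h.

(** A Bailey step under the sum over k, with s = 0 while the kernel is S_k and s = 1 once it is
    S_(k-1). *)
Lemma chain_step (F : int -> K) (s : int) (u : nat -> K) n : (n < B)%N ->
  (forall j, (j <= n)%N -> u j = qpoch (q ^+ 2) (q ^+ 2) j *
     \sum_(k <- window M) F k * bailey_ker q (k - s) j) ->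
  \sum_(j < B) qbinom q n j * g j * u j = qpoch (q ^+ 2) (q ^+ 2) n *
     \sum_(k <- window M) (q ^ binz2 (k - s + 1) * F k) * bailey_ker q (k - s) n.
Proof.
move=> nB hu.
transitivity (\sum_(j < B) \sum_(k <- window M) F k * (qbinom q n j * g j *
   (qpoch (q ^+ 2) (q ^+ 2) j * bailey_ker q (k - s) j))).
  apply: eq_bigr => j _; have [jn|nj] := leqP j n.
    by rewrite hu // !big_distrr /=; apply: eq_bigr => k _; ring.
  by rewrite (qbinom_small q nj) !mul0r big1 // => k _; rewrite !mul0r mulr0.
rewrite exchange_big big_distrr /=; apply: eq_bigr => k _.
by rewrite -big_distrr /= bailey_step_qN //; ring.
Qed.

Lemma chain_lt i x : (i < a)%N -> (x < B)%N ->
  H i x = qpoch (q ^+ 2) (q ^+ 2) x *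
    \sum_(k <- window M) (q ^ (i%:Z * binz2 (k + 1)) * f k) * bailey_ker q k x.
Proof.
elim: i x => [|i IHi] x ia xB.
  rewrite /H /= /h gtn_eqF // addn0.
  rewrite (bailey_pair_fold q0 hq hab hf hsym (leq_trans xB BM)).
  by congr (_ * _); apply: eq_bigr => k _; rewrite mul0r expr0z mul1r.
rewrite /H /= -/H /c gtn_eqF // addn0.
rewrite (@chain_step (fun k => q ^ (i%:Z * binz2 (k + 1)) * f k) 0) //.
  congr (_ * _); apply: eq_bigr => k _; rewrite subr0 mulrA -expfzDr //.
  by congr (q ^ _ * _ * _); rewrite intS mulrDl mul1r.
move=> j jx; rewrite IHi ?(ltnW ia) ?(leq_ltn_trans jx) //.
by congr (_ * _); apply: eq_bigr => k _; rewrite subr0.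
Qed.

(** The delta evaluates the preceding data at x + 1, hence the bound on [x.+1]; [bailey_shift]
    absorbs the extra factor 1 - q^(2x+2) of (q^2;q^2)_(x+1). *)
Lemma chain_shift x : (x.+1 < B)%N ->
  H a x = qpoch (q ^+ 2) (q ^+ 2) x *
    \sum_(k <- window M) (q ^ (a%:Z * binz2 (k + 1)) * f k) * bailey_ker q (k - 1) x.
Proof.
move=> xB; rewrite -(bailey_shift q0 hq) => [|k]; last first.
  (* [binz2 (k + 1)] is invariant under reflection, so the accumulated power of q preserves the
     oddness. *)
  rewrite mulrCA hsym (_ : - k - 1 + 1 = 1 - (k + 1)) ?binz2_sym; last by ring.
  by ring.
rewrite mulrA -qpochS; have [a0|a_gt0] := posnP a.
  rewrite a0 /H /= /h a0 addn1.
  rewrite (bailey_pair_fold q0 hq hab hf hsym (leq_trans xB BM)).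
  by congr (_ * _); apply: eq_bigr => k _; rewrite mul0r expr0z mul1r.
have aE : a = a.-1.+1 by rewrite prednK.
rewrite {1}aE /H /= -/H /c -aE eqxx addn1.
rewrite (@chain_step (fun k => q ^ (a.-1%:Z * binz2 (k + 1)) * f k) 0) //.
  congr (_ * _); apply: eq_bigr => k _; rewrite subr0 mulrA -expfzDr //.
  by congr (q ^ _ * _ * _); rewrite {2}aE intS mulrDl mul1r.
move=> j jx; rewrite chain_lt ?(leq_ltn_trans jx) //; last by rewrite prednK.
by congr (_ * _); apply: eq_bigr => k _; rewrite subr0.
Qed.

(** Past the shift the kernel has index k - 1, so each step adds [binz2 k] to the exponent. *)
Lemma chain_ge i x : (a <= i)%N -> (x.+1 < B)%N ->
  H i x = qpoch (q ^+ 2) (q ^+ 2) x *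
    \sum_(k <- window M)
       (q ^ (a%:Z * binz2 (k + 1) + (i%:Z - a%:Z) * binz2 k) * f k) * bailey_ker q (k - 1) x.
Proof.
elim: i x => [|i IHi] x; rewrite leq_eqVlt => /predU1P[ai|ai] xB //.
- rewrite -{1}ai chain_shift //; congr (_ * _); apply: eq_bigr => k _.
  by rewrite ai subrr !mul0r addr0.
- rewrite -{1}ai chain_shift //; congr (_ * _); apply: eq_bigr => k _.
  by rewrite ai subrr !mul0r addr0.
rewrite /H /= -/H /c ltn_eqF // addn0.
rewrite (@chain_step (fun k => q ^ (a%:Z * binz2 (k + 1) + (i%:Z - a%:Z) * binz2 k) * f k) 1) //.
- congr (_ * _); apply: eq_bigr => k _; rewrite subrK mulrA -expfzDr //.
  by congr (q ^ _ * _ * _); rewrite intS; ring.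
- exact: ltnW.
by move=> j jx; rewrite IHi ?(leq_ltn_trans _ xB).
Qed.

(** Since (q^2;q^2)_x / (-q)_x = (q)_x, the weight supplies exactly the q-binomial and the second
    (q)_x that the step with parameter q requires. *)
Lemma chain_last (F : int -> K) (s : int) (N i : nat) : (N < B)%N ->
  (forall x, (x <= N)%N -> H i x = qpoch (q ^+ 2) (q ^+ 2) x *
     \sum_(k <- window M) F k * bailey_ker q (k - s) x) ->
  \sum_(x < B) ((-1) ^+ x / qpoch (- q) q x * (qbinom q N x * qpoch q q x)) * g x * H i x
  = \sum_(k <- window M) ((sgn (k - s))%:~R * (-1) ^ (k - s) * q ^ binz2 (k - s + 1) * F k)
     * (qpoch q q N * qpoch q q N * bailey_ker q (k - s) N).
Proof.
move=> NB hH.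
transitivity (\sum_(x < B) \sum_(k <- window M) F k *
   (qbinom q N x * (-1) ^+ x * q ^+ 'C(x.+1, 2)
     * (qpoch q q x * qpoch q q x * bailey_ker q (k - s) x))).
  apply: eq_bigr => x _; have [xN|Nx] := leqP x N.
    rewrite hH // !big_distrr /=; apply: eq_bigr => k _.
    by rewrite qpoch_sqr /g; field; rewrite hNq.
  rewrite (qbinom_small q Nx) mul0r mulr0 !mul0r.
  by rewrite big1 // => k _; rewrite !mul0r mulr0.
rewrite exchange_big; apply: eq_bigr => k _.
by rewrite -big_distrr /= bailey_step_q //; ring.
Qed.

Lemma weighted_multisum m N : (0 < m)%N -> (a <= m)%N -> (N.+1 < B)%N ->
  \sum_(t : m.-tuple 'I_B) multisum_term q beta a (map_tuple val t) *
     (qbinom q N (ith (map_tuple val t) m) * qpoch q q (ith (map_tuple val t) m))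
  = \sum_(k <- window M) bilateral_term q f a m k *
     (qpoch q q N * qpoch q q N * bailey_ker q (k - (a < m)%:Z) N).
Proof.
case: m => // m _ am NB.
(* From here [m] counts the sums other than the outermost one. *)
transitivity (\sum_(x < B) ((-1) ^+ x / qpoch (- q) q x
    * (qbinom q N x * qpoch q q x)) * g x * H m x).
  rewrite -(@sum_tuple_chain K B g c h (fun x => (-1) ^+ x / qpoch (- q) q x
    * (qbinom q N x * qpoch q q x)) m).
  apply: eq_bigr => t _; rewrite /multisum_term /ith /=.
  rewrite big_add1 /= big_mkord big_add1 /= big_mkord.
  rewrite (big_morph (fun n => q ^+ n) (exprD q) (expr0 q)) /g /h /c.
  by ring.
have {}NB' := ltnW NB; rewrite /bilateral_term; case: ltnP => [lt_am|le_ma].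
  rewrite (@chain_last (fun k => q ^ (a%:Z * binz2 (k + 1) + (m%:Z - a%:Z) * binz2 k) * f k) 1) //.
    apply: eq_bigr => k _; congr (_ * _); rewrite subrK.
    (* Together with (-1)^(k-1) = -(-1)^k this produces the sign of [bilateral_term]. *)
    have -> : sgn (k - 1) = - sgn (- k) by rewrite /sgn; do 2 case: ifP; lia.
    rewrite expfzDr ?oppr_eq0 ?oner_eq0 // -[(-1) ^ (-1)]/((-1)^-1) invrN1.
    rewrite -[q ^ (_ + _ * k)]mul1r.
    have -> : q ^ (m.+1%:Z * binz2 k + a%:Z * k) = q ^ binz2 k *
       q ^ (a%:Z * binz2 (k + 1) + (m%:Z - a%:Z) * binz2 k).
      by rewrite -expfzDr // binz2D1 intS; congr (q ^ _); ring.
    by rewrite rmorphN; ring.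
  by move=> x xN; rewrite chain_ge // (leq_ltn_trans _ NB).
(* For a equal to the number of sums no delta is met, and the kernel stays unshifted. *)
have aE : a = m.+1 by apply/eqP; rewrite eqn_leq am.
rewrite (@chain_last (fun k => q ^ (m%:Z * binz2 (k + 1)) * f k) 0) //.
  apply: eq_bigr => k _; congr (_ * _); rewrite !subr0.
  have -> : q ^ (m.+1%:Z * binz2 (k + 1)) = q ^ binz2 (k + 1) * q ^ (m%:Z * binz2 (k + 1)).
    by rewrite -expfzDr // intS; congr (q ^ _); ring.
  by ring.
move=> x xN; rewrite chain_lt ?aE ?(leq_ltn_trans xN) //.
by congr (_ * _); apply: eq_bigr => k _; rewrite subr0.
Qed.

End Multisum.

(** * Dominated convergence for unconditional sums *)

Lemma sum_fsetD (T : choiceType) (V : zmodType) (u : T -> V) (J0 J : {fset T}) :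
  (J0 `<=` J)%fset ->
  \sum_(t <- J) u t = \sum_(t <- J0) u t + \sum_(t <- (J `\` J0)%fset) u t.
Proof.
move=> sub; rewrite (big_fsetID _ (mem J0)) /=; congr (_ + _).
  apply: eq_fbigl => t; rewrite !inE; case tJ0: (t \in J0); rewrite ?andbF //.
  by rewrite (fsubsetP sub).
by apply: eq_fbigl => t; rewrite !inE andbC.
Qed.

Section Summation.

Variables (R : realType) (T : choiceType).
Local Notation nc := Normc.normc.
Local Notation Re := complex.Re.
Local Notation Im := complex.Im.
Implicit Types (u : T -> R) (F : T -> R[i]) (J : {fset T}).

Lemma ler_sum_fset u J0 J : (forall t, 0 <= u t) -> (J0 `<=` J)%fset ->
  \sum_(t <- J0) u t <= \sum_(t <- J) u t.
Proof.
by move=> u0 sub; rewrite (sum_fsetD u sub) lerDl sumr_ge0.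
Qed.

Lemma nonneg_sum_cvg u B : (forall t, 0 <= u t) ->
  (forall J, \sum_(t <- J) u t <= B) ->
  exists S, forall e, 0 < e -> exists J0, forall J, (J0 `<=` J)%fset ->
    `|\sum_(t <- J) u t - S| < e.
Proof.
move=> u0 uB; pose E := [set \sum_(t <- J) u t | J in [set: {fset T}]]%classic.
have Eub : has_ubound E by exists B => _ [J _ <-]; exact: uB.
have supE : has_sup E by split => //; exists (\sum_(t <- fset0) u t), fset0.
exists (sup E) => e e0; have [_ [J0 _ <-] hJ0] := sup_adherent e0 supE.
exists J0 => J sub; have h1 := ler_sum_fset u0 sub.
have h2 : \sum_(t <- J) u t <= sup E by apply: ub_le_sup => //; exists J.
by rewrite ltr_norml; lra.
Qed.

(** Writes u as the difference of |u| and |u| - u, both nonnegative with bounded sums. *)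
Lemma real_sum_cvg u B : (forall J, \sum_(t <- J) `|u t| <= B) ->
  exists S, forall e, 0 < e -> exists J0, forall J, (J0 `<=` J)%fset ->
    `|\sum_(t <- J) u t - S| < e.
Proof.
move=> uB.
have [S1 hS1] := @nonneg_sum_cvg (fun t => `|u t|) B (fun t => normr_ge0 _) uB.
have [|J|S2 hS2] := @nonneg_sum_cvg (fun t => `|u t| - u t) (B + B).
- by move=> t; rewrite subr_ge0 ler_norm.
- rewrite sumrB lerD // -sumrN (le_trans _ (uB J)) // ler_sum // => t _.
  by rewrite -normrN ler_norm.
exists (S1 - S2) => e e0; have e2 : 0 < e / 2 by rewrite divr_gt0.
have [J1 hJ1] := hS1 _ e2; have [J2 hJ2] := hS2 _ e2.
exists (J1 `|` J2)%fset => J; rewrite fsubUset => /andP[s1 s2].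
have := hJ1 _ s1; have := hJ2 _ s2; rewrite sumrB !ltr_norml; lra.
Qed.

Lemma normc_ge0 (z : R[i]) : 0 <= nc z.
Proof. by case: z => x y; exact: sqrtr_ge0. Qed.

Lemma ler_normRe (z : R[i]) : `|Re z| <= nc z.
Proof. by rewrite -lecR; exact: normc_ge_Re. Qed.

Lemma ler_normIm (z : R[i]) : `|Im z| <= nc z.
Proof.
have := ler_normRe (z * 'i%C); rewrite ReiNIm normrN Normc.normcM.
by rewrite [nc 'i%C](_ : _ = 1) ?mulr1 //= expr0n add0r expr1n sqrtr1.
Qed.

Lemma normc_le_ReIm (z : R[i]) : nc z <= `|Re z| + `|Im z|.
Proof.
rewrite [z in nc z]complexE (le_trans (le_normcD _ _)) // lerD //.
  by rewrite /= expr0n addr0 sqrtr_sqr.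
rewrite Normc.normcM [nc 'i%C](_ : _ = 1) ?mul1r /=.
  by rewrite expr0n addr0 sqrtr_sqr.
by rewrite expr0n add0r expr1n sqrtr1.
Qed.

Lemma le_normc_sum (I : Type) (r : seq I) (F : I -> R[i]) :
  nc (\sum_(t <- r) F t) <= \sum_(t <- r) nc (F t).
Proof.
elim/big_ind2: _ => [|x1 x2 y1 y2 h1 h2|//]; first by rewrite Normc.normc0.
by rewrite (le_trans (le_normcD _ _)) // lerD.
Qed.

Lemma abs_convergent_bound F : abs_convergent F ->
  exists B, forall J, \sum_(t <- J) nc (F t) <= B.
Proof.
rewrite /abs_convergent esum.summableE => /fineK hB.
exists (fine (esum.esum [set: T]%classic (fun t => `|(nc (F t))%:E|%E))) => J.
rewrite -lee_fin hB; apply: esum.esum_ge; exists [set` J]%classic.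
  by split => //; exact: finite_fset.
rewrite -fsbig_seq ?fset_uniq // sumEFin lee_fin.
by apply: ler_sum => t _; rewrite ger0_norm // normc_ge0.
Qed.

Lemma complex_sum_cvg F : abs_convergent F ->
  exists l, forall e, 0 < e -> exists J0, forall J, (J0 `<=` J)%fset ->
    nc (\sum_(t <- J) F t - l) < e.
Proof.
move=> /abs_convergent_bound[B hB].
have [J|SR hR] := @real_sum_cvg (fun t => Re (F t)) B.
  by rewrite (le_trans _ (hB J)) // ler_sum // => t _; exact: ler_normRe.
have [J|SI hI] := @real_sum_cvg (fun t => Im (F t)) B.
  by rewrite (le_trans _ (hB J)) // ler_sum // => t _; exact: ler_normIm.
exists (Complex SR SI) => e e0; have e2 : 0 < e / 2 by rewrite divr_gt0.
have [J1 hJ1] := hR _ e2; have [J2 hJ2] := hI _ e2.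
exists (J1 `|` J2)%fset => J; rewrite fsubUset => /andP[s1 s2].
have ReE : Re (\sum_(t <- J) F t) = \sum_(t <- J) Re (F t).
  by apply: (big_morph (@Re R)) => // -[? ?] [].
have ImE : Im (\sum_(t <- J) F t) = \sum_(t <- J) Im (F t).
  by apply: (big_morph (@Im R)) => // -[? ?] [].
have := hJ1 _ s1; have := hJ2 _ s2; rewrite -ReE -ImE.
case: (\sum_(t <- J) F t) => x y h1 h2.
by rewrite (le_lt_trans (normc_le_ReIm _)) // (splitr e) ltrD.
Qed.

(** Limits along finite subsets are unique in a Hausdorff space, so [series_sum] is the limit
    constructed above. *)
Lemma series_sum_cvg F : abs_convergent F ->
  forall e, 0 < e -> exists J0, forall J, (J0 `<=` J)%fset ->
    nc (\sum_(t <- J) F t - series_sum F) < e.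
Proof.
move=> /complex_sum_cvg[l hl]; suff -> : series_sum F = l by [].
rewrite /series_sum /summability.sum.
apply: (@cvg_lim R[i]^o); first exact: norm_hausdorff.
  exact: summability.totally_filter.
have totF := @filter_filter _ _ (@summability.totally_filter T).
apply/(@cvgrPdist_lt R[i] R[i]^o) => -[e e1]; rewrite ltcE /= => /andP[/eqP -> e0].
have [J0 hJ0] := hl _ e0; exists J0 => //= J /hJ0.
rewrite -ltcR -normcN opprB /summability.partial_sum big_seq_fsetE.
by [].
Qed.

(** Split at a finite set J: on J the weights are uniformly close to 1, off J the terms have small
    absolute sum and the weights are bounded. *)
Lemma tannery F (w : nat -> T -> R[i]) (s : nat -> {fset T}) (C : R) :
  abs_convergent F -> (forall N t, nc (w N t) <= C) ->
  (forall N t, t \notin s N -> w N t = 0) ->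
  (forall t e, 0 < e -> exists N0, forall N, (N0 <= N)%N -> nc (w N t - 1) < e) ->
  forall e, 0 < e -> exists N0, forall N, (N0 <= N)%N ->
    nc (\sum_(t <- s N) F t * w N t - series_sum F) < e.
Proof.
move=> hF wC w0 w1 e e0; have [B hB] := abs_convergent_bound hF.
have [S hS] := nonneg_sum_cvg (fun t => normc_ge0 (F t)) hB.
have B0 : 0 <= B by have := hB fset0; rewrite big_seq_fset0.
pose C1 := `|C| + 1; have C1_gt0 : 0 < C1 by rewrite ltr_wpDl.
have C_C1 : C <= C1 by rewrite (le_trans (ler_norm C)) // lerDl.
(* The 6 arises because a tail is the difference of two partial sums, each this close to [S]. *)
have d0 : 0 < e / 6 / C1 by rewrite !divr_gt0.
have [J1 hJ1] := hS _ d0.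
have [J2 hJ2] := series_sum_cvg hF (divr_gt0 e0 (ltr0Sn _ 2)).
pose J := (J1 `|` J2)%fset.
have tail K : (J `<=` K)%fset -> \sum_(t <- (K `\` J)%fset) nc (F t) <= e / 3 / C1.
  move=> JK; have sumK := sum_fsetD (fun t => nc (F t)) JK.
  have J1J : (J1 `<=` J)%fset by apply: fsubsetUl.
  have := hJ1 _ J1J; have := hJ1 _ (fsubset_trans J1J JK); rewrite sumK !ltr_norml.
  have -> : e / 3 / C1 = e / 6 / C1 + e / 6 / C1 by field; rewrite gt_eqF.
  by lra.
(* [B + 1] is positive even if [B] is 0. *)
pose d := e / 3 / (B + 1).
have dpos : 0 < d by rewrite !divr_gt0 // ltr_wpDl.
have [N0 hN0] : exists N0, forall N, (N0 <= N)%N -> forall t, t \in J -> nc (w N t - 1) <= d.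
  suff [N0 hN0] : exists N0, forall N, (N0 <= N)%N ->
      forall t, t \in enum_fset J -> nc (w N t - 1) <= d by exists N0.
  elim: (enum_fset J) => [|t r [N1 hN1]]; first by exists 0%N.
  have [N2 hN2] := w1 t d dpos; exists (maxn N1 N2) => N.
  rewrite geq_max => /andP[N1N N2N] t'; rewrite inE => /predU1P[->|t'r].
    exact/ltW/hN2.
  exact: hN1.
exists N0 => N N0N; pose K := (s N `|` J)%fset.
have sK : (s N `<=` K)%fset by apply: fsubsetUl.
have JK : (J `<=` K)%fset by apply: fsubsetUr.
have -> : \sum_(t <- s N) F t * w N t = \sum_(t <- K) F t * w N t.
  by apply: big_fset_incl => // t _ tN; rewrite w0 // mulr0.
rewrite (sum_fsetD _ JK).
have -> : \sum_(t <- J) F t * w N t = \sum_(t <- J) F t * (w N t - 1) + \sum_(t <- J) F t.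
  by rewrite -big_split; apply: eq_bigr => t _ /=; ring.
set X := \sum_(t <- J) F t * (w N t - 1); set Z := \sum_(t <- (K `\` J)%fset) _.
have hX : nc X <= e / 3.
  rewrite (le_trans (le_normc_sum _ _)) //.
  have : \sum_(t <- J) nc (F t) * d <= e / 3.
    rewrite -big_distrl /= (le_trans (ler_wpM2r (ltW dpos) (hB J))) //.
    rewrite /d mulrCA ger_pMr ?divr_gt0 // ler_pdivrMr ?ltr_wpDl // mul1r.
    by rewrite lerDl.
  apply: le_trans; rewrite !big_seq ler_sum // => t tJ.
  by rewrite Normc.normcM ler_wpM2l ?normc_ge0 // hN0.
have hZ : nc Z <= e / 3.
  rewrite (le_trans (le_normc_sum _ _)) //.
  have : \sum_(t <- (K `\` J)%fset) nc (F t) * C1 <= e / 3.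
    by rewrite -big_distrl /= -ler_pdivlMr // tail.
  apply: le_trans; rewrite ler_sum // => t _.
  by rewrite Normc.normcM ler_wpM2l ?normc_ge0 // (le_trans (wC _ _)).
have hY := hJ2 _ (fsubsetUr J1 J2 : (J2 `<=` J)%fset).
rewrite (_ : X + _ + Z - _ = X + Z + (\sum_(t <- J) F t - series_sum F)); last by ring.
have := le_normcD (X + Z) (\sum_(t <- J) F t - series_sum F).
have := le_normcD X Z.
by move: hX hZ hY; set y := nc (_ - _); lra.
Qed.

End Summation.

(** * The weights *)

Section Weights.

Variables (R : realType) (q : R[i]).
Local Notation nc := Normc.normc.
Let r : R := nc q.
Hypothesis r1 : r < 1.

Let r0 : 0 <= r. Proof. exact: normc_ge0. Qed.
Let r1' : 0 < 1 - r. Proof. by rewrite subr_gt0. Qed.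
Let normcX n : nc (q ^+ n) = r ^+ n.
Proof.
elim: n => [|n IHn]; first by rewrite !expr0 Normc.normc1.
by rewrite !exprS Normc.normcM IHn.
Qed.

(** Bounds of the shape exp(a) - 1 are stable under products, since (1+s)(1+t) - 1 = st + s + t
    increases in s, t >= 0. *)
Lemma normc_sub1M (y z : R[i]) (a b : R) : nc (y - 1) <= expR a - 1 ->
  nc (z - 1) <= expR b - 1 -> nc (y * z - 1) <= expR (a + b) - 1.
Proof.
move=> ya zb; rewrite (_ : y * z - 1 = (y - 1) * (z - 1) + ((y - 1) + (z - 1))); last by ring.
have := le_normcD ((y - 1) * (z - 1)) ((y - 1) + (z - 1)).
have := le_normcD (y - 1) (z - 1); rewrite Normc.normcM expRD.
have := ler_pM (normc_ge0 _) (normc_ge0 _) ya zb.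
by lra.
Qed.

Lemma normc_prod_sub1 n (x : nat -> R[i]) :
  nc (\prod_(i < n) (1 + x i) - 1) <= expR (\sum_(i < n) nc (x i)) - 1.
Proof.
elim: n => [|n IHn].
  by rewrite !big_ord0 subrr Normc.normc0 expR0 subrr.
rewrite !big_ord_recr /=; apply: normc_sub1M => //.
by rewrite [1 + _]addrC addrK lerBrDl expR_ge1Dx.
Qed.

Lemma geometric_sum_le n m : \sum_(i < n) r ^+ (m + i) <= r ^+ m / (1 - r).
Proof.
rewrite ler_pdivlMr //.
suff -> : (\sum_(i < n) r ^+ (m + i)) * (1 - r) = r ^+ m * (1 - r ^+ n).
  by rewrite ler_piMr ?exprn_ge0 // gerBl exprn_ge0.
elim: n => [|n IHn]; first by rewrite big_ord0 expr0 subrr mul0r mulr0.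
by rewrite big_ord_recr mulrDl IHn /= exprD exprS; ring.
Qed.

(** One factor 1/(1 - r) comes from the geometric series, the other bounds 1/|1 - q^(j+1)|. *)
Let c := (1 - r)^-1 / (1 - r).

Let c0 : 0 <= c. Proof. by rewrite /c mulr_ge0 // invr_ge0 ltW. Qed.

Lemma sum_normc_le (x : nat -> R[i]) N n :
  (forall i, nc (x i) <= r ^+ (N + i) / (1 - r)) -> \sum_(i < n) nc (x i) <= c * r ^+ N.
Proof.
move=> hx; apply: le_trans (_ : \sum_(i < n) r ^+ (N + i) / (1 - r) <= _).
  by apply: ler_sum => i _.
rewrite -big_distrl /= /c mulrAC ler_wpM2r ?invr_ge0 ?(ltW r1') // [_ * r ^+ N]mulrC.
exact: geometric_sum_le.
Qed.

Lemma one_sub_normc j : 1 - r <= nc (1 - q ^+ j.+1).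
Proof.
have := le_normcD (1 - q ^+ j.+1) (q ^+ j.+1); rewrite subrK Normc.normc1 normcX.
have : r ^+ j.+1 <= r by rewrite exprS ler_piMr // exprn_ile1 // ltW.
by lra.
Qed.

Lemma one_sub_neq0 j : 1 - q ^+ j.+1 != 0.
Proof.
apply/eqP => h; have := one_sub_normc j; rewrite h Normc.normc0; have := r1'; lra.
Qed.

Lemma qpoch_near1 N n : nc (qpoch (q ^+ N.+1) q n - 1) <= expR (c * r ^+ N) - 1.
Proof.
pose x i := - (q ^+ N.+1 * q ^+ i).
rewrite (_ : qpoch _ _ _ = \prod_(i < n) (1 + x i)) //.
apply: le_trans (normc_prod_sub1 n x) _; rewrite lerB // ler_expR.
apply: sum_normc_le => i; rewrite /x normcN -exprD normcX addSn exprS.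
(* The slack 1/(1 - r) >= 1 is inserted to share [c] with the bound for the reciprocal. *)
rewrite mulrC ler_wpM2l ?exprn_ge0 // (le_trans (ltW r1)) // invf_ge1 //.
by rewrite gerBl.
Qed.

Lemma qpochV_near1 N n : nc ((qpoch (q ^+ N.+1) q n)^-1 - 1) <= expR (c * r ^+ N) - 1.
Proof.
(* 1/(1 - z) = 1 + z/(1 - z) turns the reciprocal into a product of the same kind. *)
pose x i := q ^+ (N + i).+1 / (1 - q ^+ (N + i).+1).
rewrite (_ : (qpoch _ _ _)^-1 = \prod_(i < n) (1 + x i)); last first.
  rewrite /qpoch -prodfV; apply: eq_bigr => i _.
  by rewrite -exprD addSn /x; field; rewrite one_sub_neq0.
apply: le_trans (normc_prod_sub1 n x) _; rewrite lerB // ler_expR.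
apply: sum_normc_le => i; rewrite /x Normc.normcM Normc.normcV normcX exprS.
rewrite ler_pM ?mulr_ge0 ?exprn_ge0 ?invr_ge0 ?normc_ge0 //.
  by rewrite ler_piMl ?exprn_ge0 // ltW.
by rewrite lef_pV2 ?posrE ?one_sub_normc // (lt_le_trans r1') // one_sub_normc.
Qed.

(** The weight is (q^(N-n+1))_n; the constant is doubled to agree with the kernel weight. *)
Lemma qbinom_weight_near1 N n : (n <= N)%N ->
  nc (qbinom q N n * qpoch q q n - 1) <= expR ((c + c) * r ^+ (N - n)) - 1.
Proof.
move=> nN; rewrite (qbinom_pochM one_sub_neq0 nN) -{1}(subnK nN) qpochD.
rewrite -exprS mulrAC divff ?(qpoch_neq0 one_sub_neq0) // mul1r.
apply: le_trans (qpoch_near1 _ _) _; rewrite lerB // ler_expR.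
by rewrite ler_wpM2r ?exprn_ge0 // lerDl.
Qed.

(** The weight is (q^(N-k+1))_k / (q^(N+1))_(k+1), and numerator and denominator contribute one [c]
    each. *)
Lemma bailey_ker_weight_near1 N (k : nat) : (k <= N)%N ->
  nc (qpoch q q N * qpoch q q N * bailey_ker q k N - 1)
    <= expR ((c + c) * r ^+ (N - k)) - 1.
Proof.
move=> kN; rewrite (bailey_ker_pos q kN).
have e1 : qpoch q q N = qpoch q q (N - k) * qpoch (q ^+ (N - k).+1) q k.
  by rewrite -{1}(subnK kN) qpochD -exprS.
have e2 : qpoch q q (N + k).+1 = qpoch q q N * qpoch (q ^+ N.+1) q k.+1.
  by rewrite -addnS qpochD -exprS.
have n2 := qpoch_neq0 one_sub_neq0 (N + k).+1.
have n1 := qpoch_neq0 one_sub_neq0 N.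
have n0 := qpoch_neq0 one_sub_neq0 (N - k).
have n3 : qpoch (q ^+ N.+1) q k.+1 != 0.
  by move: n2; rewrite e2 mulf_eq0 negb_or => /andP[].
have -> : qpoch q q N * qpoch q q N / (qpoch q q (N - k) * qpoch q q (N + k).+1)
    = qpoch (q ^+ (N - k).+1) q k / qpoch (q ^+ N.+1) q k.+1.
  by rewrite e2 {1}e1; field; rewrite n3 n1 n0.
apply: le_trans (normc_sub1M (qpoch_near1 _ _) (qpochV_near1 _ _)) _.
rewrite lerB // ler_expR mulrDl lerD2l ler_wpM2l //.
by rewrite ler_wiXn2l ?r0 ?(ltW r1) // leq_subr.
Qed.

Lemma expR_geometric_near1 (C e : R) : 0 < e ->
  exists N0, forall j, (N0 <= j)%N -> expR (C * r ^+ j) - 1 < e.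
Proof.
move=> e0.
have h : ((fun j => expR (C * r ^+ j)) @ \oo --> expR (C * 0 : R))%classic.
  apply: continuous_cvg; first exact: continuous_expR.
  by apply: cvgMr; apply: cvg_expr; rewrite ger0_norm.
have /cvgrPdist_lt/(_ e e0)[N0 _ hN0] := h.
exists N0 => j /hN0 /=; rewrite mulr0 expR0 distrC; apply: le_lt_trans; exact: ler_norm.
Qed.

Lemma near1_cvg (y : nat -> R[i]) (C : R) n :
  (forall N, (n <= N)%N -> nc (y N - 1) <= expR (C * r ^+ (N - n)) - 1) ->
  forall e, 0 < e -> exists N0, forall N, (N0 <= N)%N -> nc (y N - 1) < e.
Proof.
move=> hy e e0; have [N0 hN0] := expR_geometric_near1 C e0.
exists (n + N0)%N => N hN; apply: le_lt_trans (hy _ _) _; first lia.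
by apply: hN0; lia.
Qed.

Lemma near1_bounded (y : R[i]) (C : R) j : 0 <= C ->
  nc (y - 1) <= expR (C * r ^+ j) - 1 -> nc y <= expR C.
Proof.
move=> C0 hy; have := le_normcD (y - 1) 1; rewrite subrK Normc.normc1.
have : expR (C * r ^+ j) <= expR C.
  by rewrite ler_expR ler_piMr // exprn_ile1 // ltW.
by lra.
Qed.

End Weights.

(** * Limits of the two weighted sums and conclusion *)

Lemma sum_fset_uniq (T : choiceType) (V : nmodType) (r : seq T) (u : T -> V) :
  uniq r -> \sum_(t <- [fset x in r]%fset) u t = \sum_(t <- r) u t.
Proof.
by move=> ur; apply/perm_big/uniq_perm => // t; rewrite in_fset.
Qed.

Definition box (m B : nat) : seq (m.-tuple nat) :=
  [seq map_tuple val t | t <- enum {: m.-tuple 'I_B}].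

Lemma box_uniq m B : uniq (box m B).
Proof.
rewrite map_inj_uniq ?enum_uniq // => t1 t2 /(congr1 val) /= e.
by apply/val_inj/(inj_map val_inj).
Qed.

Lemma mem_box m B (t : m.-tuple nat) :
  (forall x, x \in t -> (x < B.+1)%N) -> t \in box m B.+1.
Proof.
move=> tB; apply/mapP; exists (map_tuple inord t); first by rewrite mem_enum.
apply/val_inj => /=; rewrite -map_comp -[LHS]map_id; apply/eq_in_map => x xt /=.
by rewrite inordK // tB.
Qed.

Section Main.

Variables (R : realType) (q : R[i]).
Local Notation nc := Normc.normc.
Hypothesis q1 : nc q < 1.

(** [N.+2] is the smallest box size that [weighted_multisum] accepts. *)
Lemma multisum_weighted_cvg (beta : nat -> R[i]) a m :
  abs_convergent (fun n : m.-tuple nat => multisum_term q beta a n) ->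
  forall e, 0 < e -> exists N0, forall N, (N0 <= N)%N ->
   nc (\sum_(t : m.-tuple 'I_N.+2) multisum_term q beta a (map_tuple val t) *
     (qbinom q N (ith (map_tuple val t) m) * qpoch q q (ith (map_tuple val t) m))
     - series_sum (fun n : m.-tuple nat => multisum_term q beta a n)) < e.
Proof.
move=> hleft e e0; pose c := (1 - nc q)^-1 / (1 - nc q).
have c0 : 0 <= c + c by rewrite addr_ge0 // mulr_ge0 // invr_ge0 subr_ge0 ltW.
pose y N (t : m.-tuple nat) := qbinom q N (ith t m) * qpoch q q (ith t m).
pose s N := [fset t in box m N.+2]%fset.
(* Outside the box y may be nonzero although the term vanishes; Tannery's theorem wants
   weights of finite support. *)
pose w N t := if t \in s N then y N t else 0.
have yE N t : ((ith t m <= N)%N /\ nc (y N t - 1) <= expR ((c + c) * nc q ^+ (N - ith t m)) - 1)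
    \/ y N t = 0.
  have [tN|Nt] := leqP (ith t m) N; last by right; rewrite /y qbinom_small // mul0r.
  by left; split => //; exact: qbinom_weight_near1.
have wC N t : nc (w N t) <= expR (c + c).
  rewrite /w; case: ifP => _; last by rewrite Normc.normc0 expR_ge0.
  by have [[_ /(near1_bounded q1 c0)]//|->] := yE N t; rewrite Normc.normc0 expR_ge0.
have w0 N t : t \notin s N -> w N t = 0 by rewrite /w => /negbTE ->.
have w1 t d : 0 < d -> exists N0, forall N, (N0 <= N)%N -> nc (w N t - 1) < d.
  move=> d0; pose n := \max_(x <- t) x.
  have hn x : x \in t -> (x <= n)%N by move=> xt; exact: leq_bigmax_seq.
  have [|N0 hN0] := near1_cvg q1 (y := y^~ t) (C := c + c) (n := ith t m) _ d0.
    by move=> N tN; exact: qbinom_weight_near1.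
  exists (maxn n N0) => N; rewrite geq_max => /andP[nN N0N].
  rewrite /w [t \in _](_ : _ = true) ?hN0 // in_fset mem_box // => x /hn xn.
  by rewrite ltnS (leq_trans xn) // ltnW.
have [N0 hN0] := tannery hleft wC w0 w1 e0.
exists N0 => N /hN0; congr (nc (_ - _) < e).
rewrite sum_fset_uniq ?box_uniq // big_map big_enum /=; apply: eq_bigr => t _.
congr (_ * _); rewrite /w ifT // in_fset; apply/mapP; exists t => //.
by rewrite mem_enum.
Qed.

Lemma bilateral_weighted_cvg (f : int -> R[i]) a m (s : nat) : (s <= 1)%N ->
  abs_convergent (bilateral_term q f a m) ->
  forall e, 0 < e -> exists N0, forall N, (N0 <= N)%N ->
   nc (\sum_(k <- window N.+2) bilateral_term q f a m k *
     (qpoch q q N * qpoch q q N * bailey_ker q (k - s%:Z) N)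
     - series_sum (bilateral_term q f a m)) < e.
Proof.
move=> s1 hright e e0; pose c := (1 - nc q)^-1 / (1 - nc q).
have c0 : 0 <= c + c by rewrite addr_ge0 // mulr_ge0 // invr_ge0 subr_ge0 ltW.
pose y N (k : int) := qpoch q q N * qpoch q q N * bailey_ker q k N.
(* Reflection moves every index to a nonnegative one, where the weight estimate applies. *)
have fold (k : int) : exists n : nat, forall N, y N k = y N n%:Z.
  case: k => n; exists n => // N; rewrite /y (_ : Negz n = - n%:Z - 1); last lia.
  by rewrite bailey_ker_sym.
have yC N k : nc (y N k) <= expR (c + c).
  have [n ->] := fold k; have [nN|Nn] := leqP n N.
    exact: (near1_bounded q1 c0 (bailey_ker_weight_near1 q1 nN)).
  by rewrite /y bailey_ker_eq0 ?mulr0 ?Normc.normc0 ?expR_ge0 //; lia.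
pose S N := [fset k in window N.+2]%fset.
(* The kernel lives on -N-1 <= k - s <= N, which for s <= 1 keeps k inside the window. *)
have y0 N k : k \notin S N -> y N (k - s%:Z) = 0.
  rewrite in_fset /= mem_window => kN; rewrite /y bailey_ker_eq0 ?mulr0 //.
  by move: kN; case: s s1 => [|[]] //; lia.
have y1 k d : 0 < d -> exists N0, forall N, (N0 <= N)%N -> nc (y N (k - s%:Z) - 1) < d.
  have [n hn] := fold (k - s%:Z) => d0.
  have [|N0 hN0] := near1_cvg q1 (y := y^~ n%:Z) (C := c + c) (n := n) _ d0.
    by move=> N nN; exact: bailey_ker_weight_near1.
  by exists N0 => N /hN0; rewrite hn.
have [N0 hN0] := tannery hright (fun N k => yC N _) y0 y1 e0.
exists N0 => N /hN0; congr (nc (_ - _) < e).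
by rewrite sum_fset_uniq ?window_uniq.
Qed.

End Main.

Theorem theorem1p3 (R : realType) (q : R[i]) (hq : 0 < `|q| < 1)
  (alpha beta : nat -> R[i]) (hab : bailey_pair q q alpha beta)
  (f : int -> R[i])
  (hf : forall n : nat,
     alpha n = (1 - q ^+ (2 * n + 1)) / (1 - q) * f n%:Z)
  (hsym : forall n : int, q ^ n * f n = - q ^ (- n - 1) * f (- n - 1))
  (m a : nat) (hm : (1 <= m)%N) (ha : (a <= m)%N)
  (hleft : abs_convergent (fun n : m.-tuple nat => multisum_term q beta a n))
  (hright : abs_convergent (bilateral_term q f a m)) :
  series_sum (fun n : m.-tuple nat => multisum_term q beta a n) =
  series_sum (bilateral_term q f a m).
Proof.
have /andP[q0 q1'] := hq; rewrite normr_gt0 in q0.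
have q1 : Normc.normc q < 1 by rewrite -ltcR.
have hq1 := one_sub_neq0 q1.
(* 1 + q^(i+1) = 0 would give q^(2i+2) = 1. *)
have hNq n : qpoch (- q) q n != 0.
  apply/prodf_neq0 => i _; apply/eqP => h.
  have e1 : q ^+ i.+1 = -1.
    by apply/eqP; rewrite -subr_eq0 opprK exprS addrC -[q * _]opprK -mulNr h.
  have := hq1 (i + i.+1)%N; rewrite -addSn exprD e1 mulrNN mulr1 subrr.
  by rewrite eqxx.
have ltb : ((a < m)%N <= 1)%N by case: (a < m)%N.
apply/eqP; rewrite -subr_eq0; apply/eqP/Normc.eq0_normc/eqP.
(* Both series are within e/2 of the same finite sum, for every e > 0. *)
rewrite eq_le normc_ge0 andbT; apply/ler_addgt0Pr => e e0.
have e2 : 0 < e / 2 by rewrite divr_gt0.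
have [N1 hN1] := multisum_weighted_cvg q1 hleft e2.
have [N2 hN2] := bilateral_weighted_cvg q1 ltb hright e2.
have := hN1 _ (leq_maxl N1 N2); have := hN2 _ (leq_maxr N1 N2).
set N := maxn N1 N2.
rewrite -(weighted_multisum q0 hq1 hNq hab hf hsym (leqnn N.+2) hm ha (leqnn N.+2)).
set X := \sum_t _; set L' := series_sum _; set L := series_sum _ => h1 h2.
rewrite add0r (_ : L - L' = (X - L') + - (X - L)); last by ring.
by rewrite (le_trans (le_normcD _ _)) // normcN (splitr e) lerD // ltW.
Qed.
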